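(* Let $\mathcal H$ be an infinite dimensional separable complex Hilbert space, let $T$ be a diskcyclic bounded linear operator on $\mathcal H$, and let $\lambda\in\mathbb C$ with $|\lambda|\le 1$. Then $T-\lambda I$ has dense range.
   Context: A vector $x\in\mathcal H$ is diskcyclic for a bounded linear operator $T$ on $\mathcal H$ if $\{\alpha T^n x : n\ge 0,\ \alpha\in\mathbb C,\ |\alpha|\le 1\}$ is dense in $\mathcal H$; $T$ is diskcyclic if it has a diskcyclic vector. *)

(* Defs.v *)
From HB Require Import structures.
From mathcomp Require Import all_boot all_order all_algebra sesquilinear.
From mathcomp Require Import all_classical all_reals all_analysis.
From mathcomp Require Import complex.

Set Implicit Arguments.
Unset Strict Implicit.
Unset Printing Implicit Defensive.

Import Order.TTheory GRing.Theory Num.Theory.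
Import numFieldNormedType.Exports.

Local Open Scope classical_set_scope.
Local Open Scope complex_scope.
Local Open Scope ring_scope.

(* [{dot H for Num.conj}] is linear in its first argument and conjugate-linear
   in the second. MathComp norms on an R[i]-module take values in R[i] (in its
   nonnegative reals), so both sides of [inner_normE] live in R[i]. *)
HB.mixin Record CompleteNormedModule_isHilbert (R : realType) H
    & CompleteNormedModule R[i] H := {
  inner : {dot H for (@Num.conj R[i])} ;
  inner_normE : forall x : H, inner x x = `|x| ^+ 2
}.

#[short(type="hilbertType")]
HB.structure Definition Hilbert (R : realType) :=
  {H of CompleteNormedModule R[i] H & CompleteNormedModule_isHilbert R H}.

Section HilbertSpaces.
Variables (R : realType) (H : hilbertType R).

Definition finite_dimensional : Prop :=
  exists s : seq H, forall x : H,
    exists c : 'I_(size s) -> R[i], x = \sum_(i < size s) c i *: s`_i.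

Definition infinite_dimensional : Prop := ~ finite_dimensional.

Definition separable : Prop := exists2 D : set H, countable D & dense D.

Definition bounded_operator (T : {linear H -> H}) : Prop :=
  exists M : R, forall x : H, `|T x| <= M%:C * `|x|.

Definition disk_orbit (T : {linear H -> H}) (x : H) : set H :=
  [set y | exists (n : nat) (a : R[i]), `|a| <= 1 /\ y = a *: iter n T x].

Definition diskcyclic_vector (T : {linear H -> H}) (x : H) : Prop :=
  dense (disk_orbit T x).

Definition diskcyclic (T : {linear H -> H}) : Prop :=
  exists x : H, diskcyclic_vector T x.

End HilbertSpaces.

Arguments finite_dimensional {R} H.
Arguments infinite_dimensional {R} H.
Arguments separable {R} H.

(* Main.v *)
(** Modulo the range of [T - lambda], the operator [T] acts as multiplication by
    [lambda], so every element of the disk orbit of [x] is congruent to a scalar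
    multiple of [x] of norm at most [`|x|].  Approximating [c *: y] by the orbit
    within distance 1 thus puts [y] within [(`|x| + 1) / c] of the range. *)
Require Import Defs.
From HB Require Import structures.
From mathcomp Require Import all_boot all_order all_algebra sesquilinear.
From mathcomp Require Import all_classical all_reals all_analysis.
From mathcomp Require Import complex.

Import Order.TTheory GRing.Theory Num.Theory.
Import numFieldNormedType.Exports.

Local Open Scope classical_set_scope.
Local Open Scope complex_scope.
Local Open Scope ring_scope.

(** By induction: with [u = iter n T x], [T u = lambda *: u + (T u - lambda *: u)], and scaling the
    error term of [u] by [lambda] keeps it in the range. *)
Lemma iter_linear_mod_range (K : comNzRingType) (V : lmodType K)
    (T : {linear V -> V}) (lambda : K) (x : V) (n : nat) :
  exists w, iter n T x = lambda ^+ n *: x + (T w - lambda *: w).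
Proof.
elim: n => [|n [w IHn]].
  by exists 0; rewrite /= linear0 scaler0 subr0 addr0 scale1r.
exists (lambda *: w + iter n T x).
have TwE : T (lambda *: w) - lambda *: (lambda *: w) =
    lambda *: (T w - lambda *: w) by rewrite linearZ -scalerBr.
rewrite iterS linearD scalerDr opprD addrACA TwE exprS -scalerA !addrA.
by rewrite -scalerDr -IHn addrAC subrr add0r.
Qed.

Lemma dense_ballP (K : numFieldType) (V : normedModType K) (A : set V) :
  dense A <-> forall y e, 0 < e -> exists2 z, A z & `|y - z| < e.
Proof.
split=> [dA y e e0|dA O [y Oy] oO].
  have [||z [yz Az]] := dA (ball y e); [by exists y; exact: ballxx|exact: ball_open|].
  by exists z => //; rewrite -ball_normE in yz.
have /nbhs_ballP[e /= e0 eO] : nbhs y O by exact: open_nbhs_nbhs.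
have [z Az yz] := dA y e e0.
by exists z; split=> //; apply: eO; rewrite -ball_normE.
Qed.

Theorem proposition2p3 (R : realType) (H : hilbertType R)
    (T : {linear H -> H}) (lambda : R[i]) :
  infinite_dimensional H -> separable H ->
  bounded_operator T -> diskcyclic T -> `|lambda| <= 1 ->
  dense (range (fun x : H => T x - lambda *: x)).
Proof.
move=> _ _ _ [x /dense_ballP orbx] lambda1; apply/dense_ballP => y e e0.
pose c := (`|x| + 1) / e.
have c0 : 0 < c by rewrite divr_gt0// ltr_wpDl.
have [_ [n [a [a1 ->]]] cyx] := orbx (c *: y) 1 ltr01.
have [w Tnx] := iter_linear_mod_range _ _ T lambda x n.
(* The range part of [a *: iter n T x], scaled back by [1 / c] since the orbit approximates
   [c *: y]. *)
exists (T ((a / c) *: w) - lambda *: ((a / c) *: w)); first by exists ((a / c) *: w).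
rewrite linearZ scalerA (mulrC lambda) -scalerA -scalerBr.
rewrite -(ltr_pM2l c0) -{1}(gtr0_norm c0) -normrZ [c *: (y - _)]scalerBr.
rewrite scalerA mulrCA divff ?gt_eqF// mulr1 {2}/c divfK ?gt_eqF//.
move: (T w - _) Tnx => m Tnx.
(* The first summand has norm at most [|x|] because [a] and [lambda] lie in the closed unit disk;
   the second has norm below 1 by [cyx]. *)
have -> : c *: y - a *: m = (a * lambda ^+ n) *: x + (c *: y - a *: iter n T x).
  by rewrite Tnx scalerDr scalerA opprD addrCA addNKr.
rewrite (le_lt_trans (ler_normD _ _))// ler_ltD// normrZ ler_piMl//.
by rewrite normrM normrX mulr_ile1// exprn_ile1.
Qed.
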